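(* Let $f\in H$ and let $\lambda\in\rho(A)$ with $\Re\lambda\ge a_1$. Then for every $x\in N$ (identifying $R(\lambda,A)f\in D(A)$ with its continuous representative), $$[R(\lambda,A)f](x)=\int_N K(x,x',\lambda)f(x')\,dx'.$$
   Context: Fix an integer $n\ge 2$, constants $c_1,\dots,c_n>0$ and $0\le a_1\le a_2\le\dots\le a_n<\infty$. Let $N_1,\dots,N_n$ be $n$ disjoint copies of $(0,\infty)$ and let $N$ be the star-shaped network obtained from $\overline{N_1},\dots,\overline{N_n}$ by identifying their endpoints $0$. A function $f$ on $N$ is identified with the $n$-tuple $(f_1,\dots,f_n)$ of its restrictions to the $N_k$, and $\int_N g\,dx:=\sum_k\int_{N_k}g_k\,dx$. $H=\prod_{k=1}^nL^2(N_k)$ with $(u,v)_H=\sum_k\int_0^\infty u_k\overline{v_k}$. $A$ is defined by $D(A)=\{u\in\prod_kH^2(N_k): u_i(0)=u_k(0)\ \forall i,k,\ \sum_kc_ku_k'(0^+)=0\}$, $Au=(-c_ku_k''+a_ku_k)_k$; $R(\lambda,A)=(\lambda I-A)^{-1}$. Complex square root: $\sqrt{re^{i\phi}}=\sqrt r e^{i\phi/2}$, $r\ge0$, $\phi\in[-\pi,\pi)$. For $\lambda\in\mathbb C$: $\xi_k(\lambda)=\sqrt{(\lambda-a_k)/c_k}$, $s_k(\lambda)=-\sum_{l\ne k}c_l\xi_l(\lambda)/(c_k\xi_k(\lambda))$. For $j\in\{1,\dots,n\}$, $F^{\pm,j}_\lambda:N\to\mathbb C$ is given for $x\in\overline{N_k}$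 by $F^{\pm,j}_\lambda(x)=\cos(\xi_j(\lambda)x)\pm is_j(\lambda)\sin(\xi_j(\lambda)x)$ if $k=j$ and $F^{\pm,j}_\lambda(x)=\exp(\pm i\xi_k(\lambda)x)$ if $k\ne j$. Let $w(\lambda)=i\sum_jc_j\xi_j(\lambda)$ if $\Im\lambda>0$ and $w(\lambda)=-i\sum_jc_j\xi_j(\lambda)$ if $\Im\lambda\le0$. For $\lambda$ with $w(\lambda)\ne0$, $x\in\overline{N_j}$ and $x'\in N$, define (choosing the sign $+$ if $\Im\lambda>0$ and $-$ if $\Im\lambda\le0$ throughout, and reading the index $j+1$ modulo $n$, i.e. $n+1:=1$) $K(x,x',\lambda)=\frac1{w(\lambda)}F^{\pm,j}_\lambda(x)F^{\pm,j+1}_\lambda(x')$ if $x'\in\overline{N_j}$, $x'>x$; and $K(x,x',\lambda)=\frac1{w(\lambda)}F^{\pm,j+1}_\lambda(x)F^{\pm,j}_\lambda(x')$ if $x'\in\overline{N_k}$ with $k\ne j$, or $x'\in\overline{N_j}$ with $x'<x$. *)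

(* Defs.v *)
From mathcomp Require Import all_boot all_order all_algebra.
From mathcomp Require Import all_classical all_reals all_analysis.
From mathcomp Require Import complex.

Set Implicit Arguments.
Unset Strict Implicit.
Unset Printing Implicit Defensive.
Import Order.TTheory GRing.Theory Num.Theory.
Local Open Scope ring_scope.
Local Open Scope complex_scope.
Local Open Scope classical_set_scope.

(** The half line (0, oo), the (open) edge N_k of the star network. *)
Definition halfline (R : realType) : set R := `]0%R, +oo[.

Definition cexp (R : realType) (z : R[i]) : R[i] :=
  (expR (complex.Re z))%:C * (cos (complex.Im z) +i* sin (complex.Im z)).

Definition ccos (R : realType) (z : R[i]) : R[i] :=
  (cexp ('i * z) + cexp (- ('i * z))) / 2.

Definition csin (R : realType) (z : R[i]) : R[i] :=
  (cexp ('i * z) - cexp (- ('i * z))) / (2 * 'i).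

Definition cmod (R : realType) (z : R[i]) : R :=
  Num.sqrt (complex.Re z ^+ 2 + complex.Im z ^+ 2).

(** the argument phi in [-pi, pi) with z = r e^{i phi}  (for z <> 0) *)
Definition carg (R : realType) (z : R[i]) : R :=
  if 0 < complex.Im z then acos (complex.Re z / cmod z)
  else - acos (complex.Re z / cmod z).

Definition csqrt (R : realType) (z : R[i]) : R[i] :=
  (Num.sqrt (cmod z))%:C * (cos (carg z / 2) +i* sin (carg z / 2)).

Definition cintegrable (R : realType) (D : set R) (g : R -> R[i]) : Prop :=
  (@lebesgue_measure R).-integrable D (fun x => (complex.Re (g x))%:E) /\
  (@lebesgue_measure R).-integrable D (fun x => (complex.Im (g x))%:E).

Definition cint (R : realType) (D : set R) (g : R -> R[i]) : R[i] :=
  (Rintegral (@lebesgue_measure R) D (fun x => complex.Re (g x))) +i*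
  (Rintegral (@lebesgue_measure R) D (fun x => complex.Im (g x))).

Definition csqnorm (R : realType) (z : R[i]) : R :=
  complex.Re z ^+ 2 + complex.Im z ^+ 2.

Definition inL2 (R : realType) (g : R -> R[i]) : Prop :=
  measurable_fun (@halfline R) (fun x => complex.Re (g x)) /\
  measurable_fun (@halfline R) (fun x => complex.Im (g x)) /\
  (@lebesgue_measure R).-integrable (@halfline R) (fun x => (csqnorm (g x))%:E).

Definition inH (R : realType) (n : nat) (f : 'I_n -> R -> R[i]) : Prop :=
  forall k, inL2 (f k).

Definition normsqH (R : realType) (n : nat) (f : 'I_n -> R -> R[i]) : R :=
  \sum_(k < n) Rintegral (@lebesgue_measure R) (@halfline R)
                 (fun x => csqnorm (f k x)).

(** u in H^2(0, oo), with u its continuous representative on [0, oo),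
    u1 = u' (continuous representative) and u2 = u'' (an L^2 function):
    u, u', u'' in L^2 and u, u' are the indefinite integrals of u', u''. *)
Definition H2 (R : realType) (u u1 u2 : R -> R[i]) : Prop :=
  [/\ inL2 u, inL2 u1, inL2 u2,
      forall x : R, 0 <= x ->
        cintegrable `[0%R, x] u1 /\ u x = u 0 + cint `[0%R, x] u1
    & forall x : R, 0 <= x ->
        cintegrable `[0%R, x] u2 /\ u1 x = u1 0 + cint `[0%R, x] u2].

(** u in D(A) with u' = u1, u'' = u2, and (lambda I - A) u = f in H, where
    D(A) = { u in prod H^2 : u_i(0) = u_k(0), sum_k c_k u_k'(0+) = 0 },
    (A u)_k = - c_k u_k'' + a_k u_k. *)
Definition resolvent_eq (R : realType) (n : nat) (c a : 'I_n -> R)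
    (lam : R[i]) (f u : 'I_n -> R -> R[i]) : Prop :=
  exists u1 u2 : 'I_n -> R -> R[i],
  [/\ forall k, H2 (u k) (u1 k) (u2 k),
      forall i k, u i 0 = u k 0,
      \sum_(k < n) (c k)%:C * u1 k 0 = 0
    & forall k, {ae (@lebesgue_measure R), forall x, @halfline R x ->
        lam * u k x - (- (c k)%:C * u2 k x + (a k)%:C * u k x) = f k x}].

Definition in_resolvent_set (R : realType) (n : nat) (c a : 'I_n -> R)
    (lam : R[i]) : Prop :=
  (forall f, inH f ->
     exists u, resolvent_eq c a lam f u /\
       forall v, resolvent_eq c a lam f v ->
         forall k (x : R), 0 <= x -> v k x = u k x) /\
  (exists C : R, forall f u, inH f -> resolvent_eq c a lam f u ->
     normsqH u <= C * normsqH f).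

Section Kernel.
Variables (R : realType) (n : nat) (c a : 'I_n -> R) (lam : R[i]).

Definition xi (k : 'I_n) : R[i] := csqrt ((lam - (a k)%:C) / (c k)%:C).

Definition sxi (k : 'I_n) : R[i] :=
  - (\sum_(l < n | l != k) (c l)%:C * xi l) / ((c k)%:C * xi k).

Definition sgn : R[i] := if 0 < complex.Im lam then 1 else -1.

(** F^{+-, j}_lambda at the point x of the closed edge \bar N_k *)
Definition Ffun (j k : 'I_n) (x : R) : R[i] :=
  if k == j then ccos (xi j * x%:C) + sgn * 'i * sxi j * csin (xi j * x%:C)
  else cexp (sgn * 'i * xi k * x%:C).

Definition wl : R[i] := sgn * 'i * \sum_(j < n) (c j)%:C * xi j.

(** K(x, x', lambda) for x in \bar N_j and x' in N_k; the index j+1 is read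
    modulo n (ordS). *)
Definition Kern (j : 'I_n) (x : R) (k : 'I_n) (x' : R) : R[i] :=
  if (k == j) && (x < x') then Ffun j j x * Ffun (ordS j) k x' / wl
  else Ffun (ordS j) j x * Ffun j k x' / wl.

End Kernel.

(* Main.v *)
Require Import Defs.
From mathcomp Require Import all_boot all_order all_algebra.
From mathcomp Require Import all_classical all_reals all_analysis.
From mathcomp Require Import measurable_realfun complex ring lra.
Import Order.TTheory GRing.Theory Num.Theory.
Import numFieldNormedType.Exports.
Local Open Scope ring_scope.
Local Open Scope complex_scope.
Local Open Scope classical_set_scope.
Set Implicit Arguments.
Unset Strict Implicit.
Unset Printing Implicit Defensive.

(** The kernel formula is Green's identity.  Put [k_l = +- i xi_l], so that
    [e_l t = exp (k_l t)] solves the homogeneous equation on the edge [N_l], and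
    [lambda u - A u = f] reads [f_l = c_l (u_l'' - k_l^2 u_l)].  Then [f_l e_l] is
    [c_l] times the derivative of the Wronskian [u_l' e_l - u_l e_l'].  For
    non-real [lambda] one has [Re k_l < 0], and since [u_l], [u_l'] are bounded
    the Wronskian vanishes at infinity; so the integrals of [f] against the kernel
    are boundary terms at [0] and at [x].  The terms at [0] cancel by the
    Kirchhoff conditions satisfied by [u] and by [F^{+-,j}], and those at [x]
    collapse to [u_j x] times [c_j] times the Wronskian of the two homogeneous
    solutions on [N_j], which equals [w].

    A real [lambda >= a_1] is not in the resolvent set: with
    [xi = sqrt ((lambda - a_1) / c_1)] and right-hand side
    [exp (- i xi t) / (1 + t)] on the first edge, the same identity would bound
    [int_0^x dt / (1 + t) = ln (1 + x)]. *)

(** * Indefinite integrals *)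

Section RealPrimitive.
Variable R : realType.
Notation mu := (@lebesgue_measure R).
Implicit Types f g F G : R -> R.

(** A continuous function is bounded on a compact interval, hence a bounded multiplier of integrable
    functions. *)
Lemma integrable_itvM f G (a b : R) : {within `[a, b], continuous G} ->
  mu.-integrable `[a, b] (EFin \o f) ->
  mu.-integrable `[a, b] (EFin \o (fun x => f x * G x)).
Proof.
move=> cG intf.
rewrite (_ : EFin \o _ = (EFin \o G) \* (EFin \o f))%E; last first.
  by apply/funext => x /=; rewrite mulrC.
apply: integrableMr => //.
  exact: subspace_continuous_measurable_fun.
have : compact (G @` `[a, b]) by apply: continuous_compact => //; exact: segment_compact.
move=> /compact_bounded [M [Mr MP]]; exists M; split => // N /MP {}MP x abx.
by apply: MP; exists x.
Qed.

Lemma primitive_itv_continuous f (X : R) : 0 <= X ->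
  mu.-integrable `[0, X] (EFin \o f) ->
  {within `[0, X], continuous (fun x => \int[mu]_(t in `[0, x]) f t)}.
Proof. exact: parameterized_integral_continuous. Qed.

(** Primitives of merely integrable functions need not be differentiable everywhere, so the identity
    is obtained by integrating [f s * g t] over a triangle in both orders. *)
Lemma integral_itv_by_parts f g (X : R) : 0 <= X ->
  mu.-integrable `[0, X] (EFin \o f) -> mu.-integrable `[0, X] (EFin \o g) ->
  let F x := \int[mu]_(t in `[0, x]) f t in
  let G x := \int[mu]_(t in `[0, x]) g t in
  \int[mu]_(t in `[0, X]) (f t * G t + F t * g t) = F X * G X.
Proof.
move=> X0 intf intg F G.
pose D : set R := `[0, X]; have mD : measurable D by exact: measurable_itv.
(* Extension by zero lets both iterated integrals run over the whole plane. *)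
pose f0 := (f \_ D)%R; pose g0 := (g \_ D)%R.
have if0 : mu.-integrable setT (EFin \o f0).
  by have := (@integrable_mkcond _ _ _ mu _ _ mD).1 intf; rewrite restrict_EFin.
have ig0 : mu.-integrable setT (EFin \o g0).
  by have := (@integrable_mkcond _ _ _ mu _ _ mD).1 intg; rewrite restrict_EFin.
have mf0 : measurable_fun setT f0 by apply/measurable_EFinP; exact: measurable_int if0.
have mg0 : measurable_fun setT g0 by apply/measurable_EFinP; exact: measurable_int ig0.
pose T : set (R * R) := [set z | z.1 < z.2].
have mT : measurable T.
  have := @measurable_fun_ltr _ _ R (setT : set (R * R)) fst snd measurable_fst measurable_snd.
  move=> /(_ measurableT [set true]) /(_ _); rewrite setTI.
  by apply.
(* Fubini on the triangle [s < t]. *)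
pose k (z : R * R) := (f0 z.1 * g0 z.2)%:E.
pose h (z : R * R) := (f0 z.1 * g0 z.2 * \1_T z)%:E.
have mk : measurable_fun setT k.
  apply/measurable_EFinP; apply: measurable_funM.
    exact: (measurableT_comp mf0 measurable_fst).
  exact: (measurableT_comp mg0 measurable_snd).
have mh : measurable_fun setT h.
  apply/measurable_EFinP; apply: measurable_funM; last exact: measurable_indic.
  exact/measurable_EFinP.
have ik : (mu \x mu)%E.-integrable setT k.
  apply/integrable12ltyP => //.
  have -> : (fun x => \int[mu]_y `|k (x, y)|)%E =
      (fun x => (\int[mu]_y `|(g0 y)%:E|) * `|(f0 x)%:E|)%E.
    apply/funext => x; rewrite muleC -ge0_integralZl//.
    - by apply: eq_integral => y _; rewrite /k EFinM abseM.
    - by apply: measurableT_comp => //; exact/measurable_EFinP.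
  have /integrableP[_ f0y] := if0; have /integrableP[_ g0y] := ig0.
  rewrite ge0_integralZl//; last 2 first.
    by apply: measurableT_comp => //; exact/measurable_EFinP.
    by apply: integral_ge0.
  apply: lte_mul_pinfty => //; first exact: integral_ge0.
  by rewrite ge0_fin_numE//; exact: integral_ge0.
have ih : (mu \x mu)%E.-integrable setT h.
  apply: le_integrable ik => // z _; rewrite /h /k.
  rewrite lee_fin indicE normrM; case: (z \in T); rewrite /= ?normr1 ?normr0 ?mulr1 ?mulr0//.
(* For [s] in [D] the slice of the triangle is []s, X]], over which [g] integrates to
   [G X - G s]. *)
have hF (s : R) : (\int[mu]_t h (s, t) = (((fun s => f s * (G X - G s)) \_ D)%R s)%:E)%E.
  rewrite patchE; case: ifPn => [|/negP] /[!inE] Ds; last first.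
    rewrite -[RHS](integral0 mu setT); apply: eq_integral => t _.
    by rewrite /h /f0 /= patchE memNset// !mul0r.
  have /andP[s0 sX] : 0 <= s <= X by move: Ds; rewrite /D /= in_itv.
  have subD : (`]s, X] : set R) `<=` D.
    move=> t /=; rewrite in_itv /= => /andP[st tX].
    by rewrite /D /= in_itv /= tX (le_trans s0 (ltW st)).
  have igs : mu.-integrable `]s, X] (EFin \o g) by apply: (integrableS _ _ _ intg).
  transitivity (\int[mu]_t ((f s)%:E * ((EFin \o g) \_ (`]s, X] : set R)) t))%E.
    apply: eq_integral => t _; rewrite /h /f0 /g0 /= !patchE mem_set// indicE.
    have [tI|tI] := pselect ((`]s, X] : set R) t).
      rewrite (mem_set tI) (mem_set (subD _ tI)) mem_set ?mulr1//.
      by move: tI; rewrite /T /= in_itv => /andP[].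
    rewrite (memNset tI) mule0.
    have [tD|tD] := pselect (D t); last by rewrite (memNset tD) mulr0 mul0r.
    rewrite (_ : ((s, t) \in T) = false) ?mulr0//.
    apply/negbTE/negP; rewrite inE => st; apply: tI.
    by move: tD st; rewrite /D /T /= !in_itv/= => /andP[_ ->] ->.
  rewrite integralZl//; last by apply: (integrable_mkcond _ _).1.
  rewrite -integral_mkcond (Rintegral_itvB intg) ?bnd_simp// /Rintegral.
  by rewrite EFinM fineK//; exact: integrable_fin_num.
(* For [t] in [D] the slice is [[0, t[], over which [f] integrates to [F t]. *)
have hG (t : R) : (\int[mu]_s h (s, t) = (((fun t => F t * g t) \_ D)%R t)%:E)%E.
  rewrite patchE; case: ifPn => [|/negP] /[!inE] Dt; last first.
    rewrite -[RHS](integral0 mu setT); apply: eq_integral => s _.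
    by rewrite /h /g0 /= patchE memNset// mulr0 mul0r.
  have /andP[t0 tX] : 0 <= t <= X by move: Dt; rewrite /D /= in_itv.
  have subD : (`[0, t[ : set R) `<=` D.
    move=> s /=; rewrite in_itv /= => /andP[s0 st].
    by rewrite /D /= in_itv /= s0 (le_trans (ltW st) tX).
  have ift : mu.-integrable `[0, t[ (EFin \o f) by apply: (integrableS _ _ _ intf).
  transitivity (\int[mu]_s ((g t)%:E * ((EFin \o f) \_ (`[0%R, t[ : set R)) s))%E.
    apply: eq_integral => s _; rewrite /h /f0 /g0 /= !patchE (mem_set Dt) indicE.
    have [sI|sI] := pselect ((`[0, t[ : set R) s).
      rewrite (mem_set sI) (mem_set (subD _ sI)) mem_set ?mulr1 1?mulrC//.
      by move: sI; rewrite /T /= in_itv => /andP[].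
    rewrite (memNset sI) mule0.
    have [sD|sD] := pselect (D s); last by rewrite (memNset sD) !mul0r.
    rewrite (_ : ((s, t) \in T) = false) ?mulr0//.
    apply/negbTE/negP; rewrite inE => st; apply: sI.
    by move: sD st; rewrite /D /T /= !in_itv/= => /andP[-> _] ->.
  rewrite integralZl//; last by apply: (integrable_mkcond _ _).1.
  rewrite -integral_mkcond /F -(Rintegral_itv_bndo_bndc ift) /Rintegral mulrC.
  by rewrite EFinM fineK//; exact: integrable_fin_num.
have iG : mu.-integrable D (EFin \o (fun t => f t * G t)).
  by apply: integrable_itvM => //; exact: primitive_itv_continuous.
have iF : mu.-integrable D (EFin \o (fun t => F t * g t)).
  under eq_fun do rewrite mulrC.
  by apply: integrable_itvM => //; exact: primitive_itv_continuous.
rewrite RintegralD//.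
have FXG : \int[mu]_(t in `[0, X]) (f t * G X) = F X * G X.
  by rewrite RintegralZr.
have : \int[mu]_(t in `[0, X]) (f t * (G X - G t)) = \int[mu]_(t in `[0, X]) (F t * g t).
  rewrite [LHS]Rintegral_mkcond [RHS]Rintegral_mkcond /Rintegral; congr fine.
  under eq_integral do rewrite -hF.
  under [in RHS]eq_integral do rewrite -hG.
  exact: Fubini ih.
under eq_Rintegral do rewrite mulrBr.
rewrite RintegralB// ?FXG.
  by move=> <-; rewrite addrC subrK.
rewrite (_ : EFin \o _ = (fun x => (G X)%:E * (EFin \o f) x)%E); first exact: integrableZl.
by apply/funext => x; rewrite /= mulrC EFinM.
Qed.
End RealPrimitive.

(** * Antiderivatives in integral form *)

Section AntiderivativeRules.
Variable R : realType.
Notation mu := (@lebesgue_measure R).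
Implicit Types (f g F G : R -> R) (D : set R).

Lemma Rintegrable_add D f g : measurable D ->
  mu.-integrable D (EFin \o f) -> mu.-integrable D (EFin \o g) ->
  mu.-integrable D (EFin \o (fun x => f x + g x)).
Proof.
move=> mD intf intg; rewrite (_ : EFin \o _ = (EFin \o f) \+ (EFin \o g))%E//.
exact: integrableD.
Qed.

Lemma Rintegrable_scale D f (k : R) : measurable D ->
  mu.-integrable D (EFin \o f) -> mu.-integrable D (EFin \o (fun x => k * f x)).
Proof.
move=> mD intf; rewrite (_ : EFin \o _ = (fun x => k%:E * (EFin \o f) x)%E)//.
exact: integrableZl.
Qed.

(** Local absolute continuity on [[0, oo)] with almost everywhere derivative [f]. The integral form
    is stable under products without any pointwise differentiability. *)
Definition Rprim F f := forall x, 0 <= x ->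
  mu.-integrable `[0, x] (EFin \o f) /\ F x = F 0 + \int[mu]_(t in `[0, x]) f t.

Lemma RprimD F f G g : Rprim F f -> Rprim G g ->
  Rprim (fun x => F x + G x) (fun x => f x + g x).
Proof.
move=> pF pG x x0; have [fi ->] := pF x x0; have [gi ->] := pG x x0.
split; first exact: Rintegrable_add.
by rewrite RintegralD// addrACA.
Qed.

Lemma RprimZ k F f : Rprim F f -> Rprim (fun x => k * F x) (fun x => k * f x).
Proof.
move=> pF x x0; have [fi ->] := pF x x0; split; first exact: Rintegrable_scale.
by rewrite RintegralZl// mulrDr.
Qed.

(** With [F = F 0 + P] and [G = G 0 + Q], the product [P * Q] is integration by parts, and the terms
    with the constants [F 0] and [G 0] are linear. *)
Lemma RprimM F f G g : Rprim F f -> Rprim G g ->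
  Rprim (fun x => F x * G x) (fun x => f x * G x + F x * g x).
Proof.
move=> pF pG x x0; have [fi Fx] := pF x x0; have [gi Gx] := pG x x0.
pose P y := \int[mu]_(t in `[0, y]) f t.
pose Q y := \int[mu]_(t in `[0, y]) g t.
have E : {in (`[0, x] : set R), (fun t => (f t * Q t + P t * g t) + (G 0 * f t + F 0 * g t)) =1
   (fun t => f t * G t + F t * g t)}.
  move=> t; rewrite inE /= in_itv/= => /andP[t0 tx].
  by rewrite (pF t t0).2 (pG t t0).2 -/(P t) -/(Q t); ring.
have iQ : mu.-integrable `[0, x] (EFin \o (fun t => f t * Q t)).
  by apply: integrable_itvM => //; exact: primitive_itv_continuous.
have iP : mu.-integrable `[0, x] (EFin \o (fun t => P t * g t)).
  rewrite (_ : (fun t => P t * g t) = (fun t => g t * P t)); last first.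
    by apply/funext => t; rewrite mulrC.
  by apply: integrable_itvM => //; exact: primitive_itv_continuous.
have iPQ := Rintegrable_add (measurable_itv _) iQ iP.
have iFG := Rintegrable_add (measurable_itv _)
  (Rintegrable_scale (G 0) (measurable_itv _) fi)
  (Rintegrable_scale (F 0) (measurable_itv _) gi).
split.
  have := Rintegrable_add (measurable_itv _) iPQ iFG.
  by apply: eq_integrable => // t tx; rewrite /= E.
have -> : \int[mu]_(t in `[0, x]) (f t * G t + F t * g t) =
    \int[mu]_(t in `[0, x]) ((f t * Q t + P t * g t) + (G 0 * f t + F 0 * g t)).
  by apply: eq_Rintegral => t tx; rewrite -E.
rewrite RintegralD// (integral_itv_by_parts x0 fi gi).
rewrite RintegralD//; last 2 first.
- exact: Rintegrable_scale.
- exact: Rintegrable_scale.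
rewrite RintegralZl// RintegralZl// Fx Gx; ring.
Qed.

Lemma Rprim_derive F f : (forall x : R, 0 <= x -> is_derive x 1 F (f x)) ->
  (forall x : R, 0 <= x -> {for x, continuous f}) -> Rprim F f.
Proof.
(* The degenerate interval [x = 0] is treated apart, since [continuous_FTC2] asks for [0 < x]. *)
move=> dF cf x; rewrite le_eqVlt => /predU1P[<-|x0].
  rewrite set_itv1 Rintegral_set1 addr0; split => //.
  by apply: continuous_compact_integrable; [exact: compact_set1 | exact: continuous_subspace1].
have cF y : 0 <= y -> {for y, continuous F}.
  move=> y0; apply: differentiable_continuous; apply/derivable1_diffP.
  by have := dF y y0; case.
have cwf : {within `[0, x], continuous f}.
  apply: continuous_in_subspaceT => y /[!inE] /=; rewrite in_itv/= => /andP[y0 _].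
  exact: cf.
split.
  by apply: continuous_compact_integrable => //; exact: segment_compact.
rewrite /Rintegral (continuous_FTC2 (F := F) x0 cwf) /=; last 2 first.
- split.
  + move=> y; rewrite in_itv /= => /andP[y0 _].
    by have := dF y (ltW y0); case.
  + by apply: cvg_at_right_filter; exact: cF.
  + by apply: cvg_at_left_filter; apply: cF; exact: ltW.
- move=> y; rewrite in_itv /= => /andP[y0 _].
  by rewrite derive1E; have := dF y (ltW y0); case.
by rewrite addrCA subrr addr0.
Qed.
End AntiderivativeRules.

(** * Integrals over the half line as limits *)

Section HalfLine.
Variable R : realType.
Notation mu := (@lebesgue_measure R).
Implicit Types (f g F G : R -> R) (D : set R).

Lemma measurable_halfline : measurable (@halfline R).
Proof. exact: measurable_itv. Qed.
Hint Resolve measurable_halfline : core.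

(** Dominated convergence: the integral over [[0, n]] is the half-line integral of [f] cut off at
    [n], and the cut-offs are dominated by the absolute value of [f]. *)
Lemma Rintegral_halfline_cvg F f : Rprim F f ->
  mu.-integrable (@halfline R) (EFin \o f) ->
  F n%:R @[n --> \oo] --> F 0 + \int[mu]_(t in (@halfline R)) f t.
Proof.
move=> pF fi.
have E : (fun n => F n%:R) = (fun n => F 0 + \int[mu]_(t in `[0, n%:R]) f t).
  by apply/funext => n; exact: (pF _ (ler0n _ _)).2.
rewrite E; apply: cvgD; first exact: cvg_cst.
have mf := measurable_int _ fi.
pose fn n := (EFin \o f) \_ (`[0, n%:R] : set R).
have E2 n : (\int[mu]_(t in `[0%R, n%:R]) (f t)%:E)%E =
            (\int[mu]_(t in @halfline R) fn n t)%E.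
  rewrite -integral_mkcondr.
  have -> : @halfline R `&` `[0, n%:R] = `]0, n%:R].
    apply/seteqP; split => t /=; rewrite /halfline /= !in_itv /=.
      by move=> [/andP[-> _] /andP[_ ->]].
    by move=> /andP[t0 ->]; rewrite t0 (ltW t0).
  rewrite integral_itv_obnd_cbnd//.
  apply: measurable_funS mf => //.
  by move=> t /=; rewrite /halfline /= !in_itv /= => /andP[->].
apply: (@fine_cvg _ _ _ _ (fun n => \int[mu]_(t in `[0%R, n%:R]) (f t)%:E)%E).
rewrite fineK; last exact: integrable_fin_num.
under eq_fun do rewrite E2.
have [] := @dominated_convergence _ _ _ mu (@halfline R) _ fn
  (EFin \o f) (abse \o (EFin \o f)).
- exact: measurable_halfline.
- move=> n; have mn : measurable (`[0, n%:R] : set R) by exact: measurable_itv.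
  have [+ _] := measurable_restrict (EFin \o f) mn measurable_halfline; apply.
  by apply: measurable_funS mf => // t [].
- exact: mf.
- apply: aeW => t ht.
  apply: cvg_near_cst.
  near=> n; rewrite /fn patchE mem_set//=.
  move: ht; rewrite /halfline /= !in_itv /= => /andP[/ltW -> _] /=.
  near: n; exact: nbhs_infty_ger.
- exact: integrable_abse.
- apply: aeW => t n ht; rewrite /fn patchE; case: ifPn => // _.
  by rewrite abse0 abse_ge0.
- by [].
Unshelve. all: end_near.
Qed.

(** Integrability makes [F n] converge, and the exponential bound forces the limit to be [0]. The
    bound is put on the square because that is what estimates of [csqnorm] provide. *)
Lemma Rintegral_halfline_decay F f (K b : R) : Rprim F f ->
  mu.-integrable (@halfline R) (EFin \o f) -> 0 < b ->
  (forall x, 0 <= x -> F x ^+ 2 <= K * expR (- (b * x))) ->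
  \int[mu]_(t in (@halfline R)) f t = - F 0.
Proof.
move=> pF fi b0 FK.
have := Rintegral_halfline_cvg pF fi.
set l := (X in _ --> X) => Fl.
suff : l = 0 by move/eqP; rewrite /l addrC addr_eq0 => /eqP.
apply/eqP; rewrite -sqrf_eq0 eq_le sqr_ge0 andbT.
have F2 : (F n%:R ^+ 2) @[n --> \oo] --> l ^+ 2.
  by rewrite expr2; under eq_fun do rewrite expr2; exact: cvgM.
have E0 : (K * expR (- (b * n%:R))) @[n --> \oo] --> 0.
  rewrite -[X in _ --> X](mulr0 K); apply: cvgM; first exact: cvg_cst.
  apply: (@cvg_comp _ _ _ (fun n : nat => b * n%:R) (fun x => expR (- x)) _ (pinfty_nbhs R)).
    apply/cvgryPge => A; have := @nbhs_infty_ger R (A / b).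
    by apply: filterS => n; rewrite ler_pdivrMr// mulrC.
  exact: cvgr_expR.
apply: ler_cvg_to F2 E0 _; apply: nearW => n; exact: FK.
Qed.

End HalfLine.

(** * Complex-valued integrals *)

Section ReIm.
Variable R : realType.
Implicit Types x y z : R[i].

Lemma complex_ext x y : complex.Re x = complex.Re y -> complex.Im x = complex.Im y -> x = y.
Proof. by case: x y => [a b] [c d] /= -> ->. Qed.

Lemma cReD x y : complex.Re (x + y) = complex.Re x + complex.Re y.
Proof. by case: x y => [a b] []. Qed.
Lemma cImD x y : complex.Im (x + y) = complex.Im x + complex.Im y.
Proof. by case: x y => [a b] []. Qed.
Lemma cReN x : complex.Re (- x) = - complex.Re x.
Proof. by case: x. Qed.
Lemma cImN x : complex.Im (- x) = - complex.Im x.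
Proof. by case: x. Qed.
Lemma cReM x y : complex.Re (x * y) =
  complex.Re x * complex.Re y - complex.Im x * complex.Im y.
Proof. by case: x y => [a b] []. Qed.
Lemma cImM x y : complex.Im (x * y) =
  complex.Re x * complex.Im y + complex.Im x * complex.Re y.
Proof. by case: x y => [a b] []. Qed.

Lemma cReZ (a : R) z : complex.Re (a%:C * z) = a * complex.Re z.
Proof. by rewrite cReM /= mul0r subr0. Qed.
Lemma cImZ (a : R) z : complex.Im (a%:C * z) = a * complex.Im z.
Proof. by rewrite cImM /= mul0r addr0. Qed.

Definition cReImE := (cReD, cImD, cReN, cImN, cReM, cImM).

Lemma csqnormM x y : csqnorm (x * y) = csqnorm x * csqnorm y.
Proof. by rewrite /csqnorm !cReImE; ring. Qed.

Lemma csqnormN x : csqnorm (- x) = csqnorm x.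
Proof. by rewrite /csqnorm !cReImE !sqrrN. Qed.

Lemma csqnorm_ge0 x : 0 <= csqnorm x.
Proof. by rewrite addr_ge0 ?sqr_ge0. Qed.

Lemma csqnormD x y : csqnorm (x + y) <= 2 * (csqnorm x + csqnorm y).
Proof.
rewrite /csqnorm !cReImE -subr_ge0.
set a := complex.Re x; set b := complex.Im x; set c := complex.Re y; set d := complex.Im y.
(* Parallelogram law: the difference of the two sides is [csqnorm (x - y)]. *)
rewrite (_ : _ - _ = (a - c) ^+ 2 + (b - d) ^+ 2); last by ring.
by rewrite addr_ge0 ?sqr_ge0.
Qed.

Lemma cexpD x y : cexp (x + y) = cexp x * cexp y.
Proof. by rewrite /cexp; apply: complex_ext; rewrite /= !cReImE /= expRD ?cosD ?sinD; ring. Qed.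

Lemma cexp0 : cexp (0 : R[i]) = 1.
Proof.
rewrite /cexp /= expR0 cos0 sin0; apply: complex_ext;
  by rewrite /= ?mul1r ?mul0r ?subr0 ?addr0.
Qed.

Lemma csqnorm_cexp z : csqnorm (cexp z) = expR (2 * complex.Re z).
Proof.
rewrite /cexp csqnormM /csqnorm /= cos2Dsin2 mulr1 expr0n addr0.
by rewrite (_ : 2 * _ = complex.Re z + complex.Re z) ?expRD ?expr2//; ring.
Qed.

Lemma Re_cexp_line (k : R[i]) (x : R) : complex.Re (cexp (k * x%:C)) =
  expR (complex.Re k * x) * cos (complex.Im k * x).
Proof. by rewrite /cexp /= !cReImE /= !mulr0 subr0 add0r mul0r subr0. Qed.

Lemma Im_cexp_line (k : R[i]) (x : R) : complex.Im (cexp (k * x%:C)) =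
  expR (complex.Re k * x) * sin (complex.Im k * x).
Proof. by rewrite /cexp /= !cReImE /= !mulr0 subr0 add0r mul0r addr0. Qed.

End ReIm.

Section ComplexIntegral.
Variable R : realType.
Notation mu := (@lebesgue_measure R).
Implicit Types (g h : R -> R[i]) (D : set R).

Lemma cintegrableD D g h : measurable D -> cintegrable D g -> cintegrable D h ->
  cintegrable D (fun x => g x + h x).
Proof.
move=> mD [g1 g2] [h1 h2]; split; under eq_fun do rewrite !cReImE;
  exact: Rintegrable_add.
Qed.

Lemma cintegrableZ D k g : measurable D -> cintegrable D g ->
  cintegrable D (fun x => k * g x).
Proof.
move=> mD [g1 g2]; split; under eq_fun do rewrite !cReImE -?mulNr;
  by apply: Rintegrable_add => //; exact: Rintegrable_scale.
Qed.

Lemma eq_cintegrable D g h : measurable D -> (forall x, D x -> g x = h x) ->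
  cintegrable D g -> cintegrable D h.
Proof.
move=> mD gh [g1 g2]; split; [move: g1|move: g2]; apply: eq_integrable => // x /[!inE] Dx;
  by rewrite gh.
Qed.

Lemma eq_cint D g h : (forall x, D x -> g x = h x) -> cint D g = cint D h.
Proof.
by move=> gh; congr (_ +i* _); apply: eq_Rintegral => x /[!inE] Dx; rewrite gh.
Qed.

Lemma cintegrableS E D g : measurable E -> measurable D -> D `<=` E ->
  cintegrable E g -> cintegrable D g.
Proof. by move=> mE mD DE [g1 g2]; split; [move: g1|move: g2]; apply: integrableS. Qed.

Lemma cintD D g h : measurable D -> cintegrable D g -> cintegrable D h ->
  cint D (fun x => g x + h x) = cint D g + cint D h.
Proof.
move=> mD [g1 g2] [h1 h2]; rewrite /cint; apply: complex_ext; rewrite /= ?cReImE /= -RintegralD//;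
  by apply: eq_Rintegral => x _; rewrite !cReImE.
Qed.

Lemma cintZ D k g : measurable D -> cintegrable D g ->
  cint D (fun x => k * g x) = k * cint D g.
Proof.
move=> mD [g1 g2]; rewrite /cint; apply: complex_ext; rewrite ?cReImE /=.
  rewrite -!RintegralZl// -RintegralB; [|by []|exact: Rintegrable_scale..].
  by apply: eq_Rintegral => x _; rewrite !cReImE.
rewrite -!RintegralZl// -RintegralD; [|by []|exact: Rintegrable_scale..].
by apply: eq_Rintegral => x _; rewrite !cReImE.
Qed.

Lemma cint_setU (A B : set R) g : measurable A -> measurable B ->
  [disjoint A & B] -> cintegrable (A `|` B) g ->
  cint (A `|` B) g = cint A g + cint B g.
Proof.
move=> mA mB AB [g1 g2]; rewrite /cint !Rintegral_setU//.
Qed.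

Lemma cintegrable_setU (A B : set R) g : measurable A -> measurable B ->
  [disjoint A & B] ->
  cintegrable A g -> cintegrable B g -> cintegrable (A `|` B) g.
Proof.
move=> mA mB AB.
have K (f : R -> R) : mu.-integrable A (EFin \o f) -> mu.-integrable B (EFin \o f) ->
    mu.-integrable (A `|` B) (EFin \o f).
  move=> /integrableP[mfA fA] /integrableP[mfB fB].
  have mfAB : measurable_fun (A `|` B) (EFin \o f) by apply/measurable_funU.
  apply/integrableP; split => //.
  rewrite ge0_integral_setU//; first exact: lte_add_pinfty.
  exact: measurableT_comp.
by move=> [A1 A2] [B1 B2]; split; exact: K.
Qed.

(* The form in which [H2] expresses that [F] is locally absolutely continuous with
   derivative [f]. *)
Definition prim (F f : R -> R[i]) := forall x : R, 0 <= x ->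
  cintegrable `[0%R, x] f /\ F x = F 0 + cint `[0%R, x] f.

Lemma primP F f : prim F f <->
  Rprim (fun x => complex.Re (F x)) (fun x => complex.Re (f x)) /\
  Rprim (fun x => complex.Im (F x)) (fun x => complex.Im (f x)).
Proof.
split=> [pF|[p1 p2] x x0].
  by split => x x0; have [[i1 i2] ->] := pF x x0; rewrite /= !cReImE.
have [i1 e1] := p1 x x0; have [i2 e2] := p2 x x0.
by split; [|apply: complex_ext; rewrite !cReImE].
Qed.

Lemma primD F f G g : prim F f -> prim G g ->
  prim (fun x => F x + G x) (fun x => f x + g x).
Proof.
move=> /primP[F1 F2] /primP[G1 G2]; apply/primP; split.
  by have := RprimD F1 G1; congr (Rprim _ _); apply/funext => x; rewrite cReD.
by have := RprimD F2 G2; congr (Rprim _ _); apply/funext => x; rewrite cImD.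
Qed.

Lemma primM F f G g : prim F f -> prim G g ->
  prim (fun x => F x * G x) (fun x => f x * G x + F x * g x).
Proof.
move=> /primP[F1 F2] /primP[G1 G2]; apply/primP; split.
  have := RprimD (RprimM F1 G1) (RprimZ (-1) (RprimM F2 G2)).
  by congr (Rprim _ _); apply/funext => x; rewrite !cReImE; ring.
have := RprimD (RprimM F1 G2) (RprimM F2 G1).
by congr (Rprim _ _); apply/funext => x; rewrite !cReImE; ring.
Qed.

Lemma prim_cst (c : R[i]) : prim (fun=> c) (fun=> 0).
Proof.
have r0 (a : R) : Rprim (fun=> a) (fun=> 0).
  by apply: Rprim_derive => x _; exact: cst_continuous.
by apply/primP; split; exact: r0.
Qed.

Lemma primZ k F f : prim F f -> prim (fun x => k * F x) (fun x => k * f x).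
Proof.
move=> pF; have := primM (prim_cst k) pF.
by congr (prim _ _); apply/funext => x; rewrite mul0r add0r.
Qed.

(** The real and imaginary parts are a real exponential times a cosine or a sine, so the product
    rule applies. *)
Lemma prim_cexp (k : R[i]) : prim (fun x => cexp (k * x%:C)) (fun x => k * cexp (k * x%:C)).
Proof.
have cont (h : R -> R) (x d : R) : is_derive x 1 h d -> {for x, continuous h}.
  by case=> dh _; apply: differentiable_continuous; apply/derivable1_diffP.
have dexp (a : R) : Rprim (fun x => expR (a * x)) (fun x => a * expR (a * x)).
  apply: Rprim_derive => x _.
    apply: is_derive_eq; rewrite /GRing.scale /=; ring.
  exact: cont.
have dcos (a : R) : Rprim (fun x => cos (a * x)) (fun x => - a * sin (a * x)).
  apply: Rprim_derive => x _.
    apply: is_derive_eq; rewrite /GRing.scale /=; ring.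
  exact: cont.
have dsin (a : R) : Rprim (fun x => sin (a * x)) (fun x => a * cos (a * x)).
  apply: Rprim_derive => x _.
    apply: is_derive_eq; rewrite /GRing.scale /=; ring.
  exact: cont.
apply/primP; split.
  have := RprimM (dexp (complex.Re k)) (dcos (complex.Im k)).
  congr (Rprim _ _); apply/funext => x.
    by rewrite Re_cexp_line.
  by rewrite [RHS]cReM Re_cexp_line Im_cexp_line; ring.
have := RprimM (dexp (complex.Re k)) (dsin (complex.Im k)).
congr (Rprim _ _); apply/funext => x.
  by rewrite Im_cexp_line.
by rewrite [RHS]cImM Re_cexp_line Im_cexp_line; ring.
Qed.

End ComplexIntegral.

(** * Square-integrable functions *)

Section SquareIntegrable.
Variable R : realType.
Notation mu := (@lebesgue_measure R).
Implicit Types (g h u v : R -> R[i]) (D : set R).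

(** Membership in L^2 relative to a set, because Green's identity is used both on the half line and
    on []0, x]]. *)
Definition inL2on D g := [/\ measurable_fun D (fun x => complex.Re (g x)),
  measurable_fun D (fun x => complex.Im (g x)) &
  mu.-integrable D (EFin \o (fun x => csqnorm (g x)))].

Lemma inL2P g : inL2 g <-> inL2on (@halfline R) g.
Proof. by split => [[? []]|[]]. Qed.

Lemma inL2onS E D g : measurable E -> measurable D -> D `<=` E ->
  inL2on E g -> inL2on D g.
Proof.
move=> mE mD DE [g1 g2 gi]; split; first exact: measurable_funS g1.
  exact: measurable_funS g2.
by move: gi; apply: integrableS.
Qed.

Lemma measurable_csqnorm D g : measurable D -> measurable_fun D (fun x => complex.Re (g x)) ->
  measurable_fun D (fun x => complex.Im (g x)) ->
  measurable_fun D (fun x => csqnorm (g x)).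
Proof. by move=> mD m1 m2; apply: measurable_funD; apply: measurable_funX. Qed.

Lemma inL2onZ D k g : measurable D -> inL2on D g -> inL2on D (fun x => k * g x).
Proof.
move=> mD [g1 g2 gi]; split.
- under eq_fun do rewrite cReM.
  by apply: measurable_funB; apply: measurable_funM => //; exact: measurable_cst.
- under eq_fun do rewrite cImM.
  by apply: measurable_funD; apply: measurable_funM => //; exact: measurable_cst.
- have := Rintegrable_scale (csqnorm k) mD gi.
  by apply: eq_integrable => // x _ /=; rewrite csqnormM.
Qed.

Lemma inL2onD D g h : measurable D -> inL2on D g -> inL2on D h ->
  inL2on D (fun x => g x + h x).
Proof.
move=> mD [g1 g2 gi] [h1 h2 hi].
have m1 : measurable_fun D (fun x => complex.Re (g x + h x)).
  by under eq_fun do rewrite cReD; exact: measurable_funD.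
have m2 : measurable_fun D (fun x => complex.Im (g x + h x)).
  by under eq_fun do rewrite cImD; exact: measurable_funD.
split => //.
have := Rintegrable_scale 2 mD (Rintegrable_add mD gi hi).
apply: le_integrable => //.
  by apply/measurable_EFinP; exact: measurable_csqnorm.
move=> x _ /=; rewrite lee_fin ger0_norm ?csqnorm_ge0// (le_trans (csqnormD _ _))//.
exact: ler_norm.
Qed.

Lemma inL2onM D g h : measurable D -> inL2on D g -> inL2on D h ->
  cintegrable D (fun x => g x * h x).
Proof.
move=> mD [g1 g2 gi] [h1 h2 hi].
have S := Rintegrable_add mD gi hi.
(* Young's inequality in the shape of the real part of a product; the imaginary part is the same
   with [(c, d)] replaced by [(d, - c)]. *)
have key (a b c d : R) : `|a * c - b * d| <= `|(a ^+ 2 + b ^+ 2) + (c ^+ 2 + d ^+ 2)|.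
  rewrite [leRHS]ger0_norm; last by rewrite !addr_ge0 ?sqr_ge0.
  have := (sqr_ge0 (a - c), sqr_ge0 (a + c), sqr_ge0 (b - d), sqr_ge0 (b + d)).
  by case=> [[[]]] *; rewrite ler_norml; apply/andP; split; nra.
split; apply: le_integrable S => //.
- apply/measurable_EFinP; under eq_fun do rewrite cReM.
  by apply: measurable_funB; apply: measurable_funM.
- by move=> x _ /=; rewrite lee_fin cReM; exact: key.
- apply/measurable_EFinP; under eq_fun do rewrite cImM.
  by apply: measurable_funD; apply: measurable_funM.
- move=> x _ /=; rewrite lee_fin cImM -[X in _ + X]opprK -mulrN [X in _ <= `|_ + X|]addrC.
  by rewrite -[X in _ <= `|_ + (_ + X)|]sqrrN; exact: key.
Qed.

Lemma measurable_cexp_line D (k : R[i]) : measurable D ->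
  measurable_fun D (fun x => complex.Re (cexp (k * x%:C))) /\
  measurable_fun D (fun x => complex.Im (cexp (k * x%:C))).
Proof.
move=> mD.
have ml (a : R) : measurable_fun D (fun x => a * x).
  by apply: measurable_funM => //; exact: measurable_cst.
have me : measurable_fun D (fun x => expR (complex.Re k * x)).
  by apply: measurableT_comp => //; exact: measurable_expR.
split.
  under eq_fun do rewrite Re_cexp_line.
  apply: measurable_funM => //; apply: measurableT_comp => //.
  by apply: continuous_measurable_fun; exact: continuous_cos.
under eq_fun do rewrite Im_cexp_line.
apply: measurable_funM => //; apply: measurableT_comp => //.
by apply: continuous_measurable_fun; exact: continuous_sin.
Qed.

Lemma csqnorm_cexp_line (k : R[i]) (x : R) :
  csqnorm (cexp (k * x%:C)) = expR (2 * complex.Re k * x).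
Proof. by rewrite csqnorm_cexp cReM /= mulr0 subr0 mulrA. Qed.

Lemma inL2on_cexp_itv (k : R[i]) (x : R) : inL2on `]0, x] (fun t => cexp (k * t%:C)).
Proof.
have mA : measurable (`]0, x] : set R) by exact: measurable_itv.
have [m1 m2] := measurable_cexp_line k mA.
split => //.
have : mu.-integrable `[0, x] (EFin \o (fun t => expR (2 * complex.Re k * t))).
  apply: continuous_compact_integrable; first exact: segment_compact.
  apply: continuous_subspaceT => t.
  apply: continuous_comp; last exact: continuous_expR.
  by apply: cvgM; [exact: cvg_cst|exact: cvg_id].
move=> h; have : mu.-integrable `]0, x] (EFin \o (fun t => expR (2 * complex.Re k * t))).
  by move: h; apply: integrableS => //; exact: subset_itv_oc_cc.
by apply: eq_integrable => // t _ /=; rewrite csqnorm_cexp_line.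
Qed.

Lemma inL2on_cexp (k : R[i]) : complex.Re k < 0 ->
  inL2on (@halfline R) (fun t => cexp (k * t%:C)).
Proof.
move=> k0.
have mH : measurable (@halfline R) by exact: measurable_itv.
have [m1 m2] := measurable_cexp_line k mH.
split => //.
(* The squared modulus [expR (- r * t)] is [r^-1] times the density of the exponential law of rate
   [r]. *)
pose r := - (2 * complex.Re k).
have r0 : 0 < r by rewrite /r; nra.
have : mu.-integrable (@halfline R) (EFin \o exponential_pdf r).
  by have := integrable_exponential_pdf r0; apply: integrableS.
move=> /(Rintegrable_scale r^-1 mH).
apply: eq_integrable => // t; rewrite inE /halfline /= in_itv /= => /andP[t0 _].
rewrite csqnorm_cexp_line /= exponential_pdfE ?ltW//= mulKf ?gt_eqF//.
by rewrite /r opprK.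
Qed.

(** The embedding of H^1 into L^oo: the derivative of [csqnorm u] is twice the real part of [v]
    times the conjugate of [u], which is at most the integrable function [csqnorm u + csqnorm v]. *)
Lemma prim_bounded u v : prim u v -> inL2 u -> inL2 v ->
  exists M, forall x, 0 <= x -> csqnorm (u x) <= M.
Proof.
move=> /primP[p1 p2] /inL2P[u1 u2 ui] /inL2P[v1 v2 vi].
have mH : measurable (@halfline R) by exact: measurable_itv.
pose S x := csqnorm (u x) + csqnorm (v x).
have Si : mu.-integrable (@halfline R) (EFin \o S).
  by apply: Rintegrable_add.
have S0 x : 0 <= S x by rewrite addr_ge0 ?csqnorm_ge0.
exists (csqnorm (u 0) + \int[mu]_(t in @halfline R) S t) => x x0.
have P := RprimD (RprimM p1 p1) (RprimM p2 p2).
have [di] := P x x0; rewrite -!expr2 -/(csqnorm (u x)) -/(csqnorm (u 0)) => ->.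
rewrite lerD2l.
have sub : `]0, x] `<=` @halfline R.
  by move=> t; rewrite /halfline /= !in_itv/= => /andP[->].
have di' := di; move: di' => /integrableS -/(_ (`]0, x] : set R)) di'.
have {}di' := di' (measurable_itv _) (measurable_itv _) (@subset_itv_oc_cc _ _ _ _).
have Si' : mu.-integrable `]0, x] (EFin \o S) by move: Si; apply: integrableS.
rewrite -Rintegral_itv_obnd_cbnd//.
apply: (@le_trans _ _ (\int[mu]_(t in `]0, x]) S t)).
  apply: le_Rintegral => // t _; rewrite /S /csqnorm.
  have := sqr_ge0 (complex.Re (u t) - complex.Re (v t)).
  have := sqr_ge0 (complex.Im (u t) - complex.Im (v t)).
  by nra.
apply: fine_le; [exact: (integrable_fin_num _ Si')|exact: (integrable_fin_num _ Si)|].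
apply: ge0_subset_integral => //; first exact: measurable_int Si.
by move=> t _; rewrite lee_fin.
Qed.

Lemma cint_halfline_decay u v (K b : R) : prim u v -> cintegrable (@halfline R) v ->
  0 < b -> (forall x, 0 <= x -> csqnorm (u x) <= K * expR (- (b * x))) ->
  cint (@halfline R) v = - u 0.
Proof.
move=> /primP[p1 p2] [v1 v2] b0 uK; rewrite /cint.
rewrite (Rintegral_halfline_decay p1 v1 b0 (K := K)).
  rewrite (Rintegral_halfline_decay p2 v2 b0 (K := K)); first by apply: complex_ext; rewrite !cReImE.
  by move=> x x0; apply: le_trans (uK x x0); rewrite lerDr sqr_ge0.
by move=> x x0; apply: le_trans (uK x x0); rewrite lerDl sqr_ge0.
Qed.

Lemma prim_wronskian u u1 u2 (p p1 p2 : R -> R[i]) :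
  prim u u1 -> prim u1 u2 -> prim p p1 -> prim p1 p2 ->
  prim (fun x => u1 x * p x - u x * p1 x) (fun x => u2 x * p x - u x * p2 x).
Proof.
move=> U U1 P P1; have := primD (primM U1 P) (primZ (-1) (primM U P1)).
by congr (prim _ _); apply/funext => x; ring.
Qed.

End SquareIntegrable.

(** * Green's identity *)

Section Green.
Variable R : realType.
Notation mu := (@lebesgue_measure R).
Implicit Types (g h u v f : R -> R[i]) (D : set R).

Lemma ae_impl (P Q : R -> Prop) : (forall x, P x -> Q x) ->
  {ae mu, forall x, P x} -> {ae mu, forall x, Q x}.
Proof.
by move=> PQ [N [mN N0 PN]]; exists N; split => // x /= nQ; apply: PN => /= Px; apply/nQ/PQ.
Qed.

Lemma ae_eq_cint D g h : measurable D -> cintegrable D g -> cintegrable D h ->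
  {ae mu, forall x, D x -> g x = h x} -> cint D g = cint D h.
Proof.
move=> mD [g1 g2] [h1 h2] gh; rewrite /cint /Rintegral.
congr (fine _ +i* fine _); apply: ae_eq_integral => //.
- exact: measurable_int g1.
- exact: measurable_int h1.
- by apply: ae_impl gh => x gx Dx /=; rewrite gx.
- exact: measurable_int g2.
- exact: measurable_int h2.
- by apply: ae_impl gh => x gx Dx /=; rewrite gx.
Qed.

Lemma cint_itv_obnd_cbnd (x : R) g : cintegrable `[0, x] g ->
  cintegrable `]0, x] g /\ cint `]0, x] g = cint `[0, x] g.
Proof.
move=> ig; have iA : cintegrable `]0, x] g.
  by move: ig; apply: cintegrableS => //; exact: subset_itv_oc_cc.
by split => //; case: iA => i1 i2; rewrite /cint !Rintegral_itv_obnd_cbnd.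
Qed.

(** The exponents [m = k] and [m = - k] both give solutions of [p'' = k^2 p], so only the defect
    [u2 - k ^+ 2 * u] survives in the derivative of the Wronskian. *)
Lemma cexp_wronskian u u1 u2 (k m : R[i]) : prim u u1 -> prim u1 u2 ->
  m ^+ 2 = k ^+ 2 ->
  prim (fun x => u1 x * cexp (m * x%:C) - u x * (m * cexp (m * x%:C)))
       (fun x => cexp (m * x%:C) * (u2 x - k ^+ 2 * u x)).
Proof.
move=> U U1 mk; have := prim_wronskian U U1 (prim_cexp m) (primZ m (prim_cexp m)).
by congr (prim _ _); apply/funext => x; rewrite -mk; ring.
Qed.

Lemma H2_prim u u1 u2 : H2 u u1 u2 -> prim u u1 /\ prim u1 u2.
Proof. by case. Qed.

Variables (c : R) (k : R[i]) (f u u1 u2 : R -> R[i]).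
Hypotheses (hu : H2 u u1 u2) (hf : inL2 f).
Hypothesis eqf : {ae mu, forall x, @halfline R x ->
  f x = c%:C * (u2 x - k ^+ 2 * u x)}.

(** The Wronskian is evaluated between [0] and [x]. On a bounded interval the growing exponential is
    admissible too, and [G] in the kernel contains it. *)
Lemma itv_green (m : R[i]) (x : R) : m ^+ 2 = k ^+ 2 -> 0 <= x ->
  cintegrable `]0, x] (fun t => cexp (m * t%:C) * f t) /\
  cint `]0, x] (fun t => cexp (m * t%:C) * f t) =
    c%:C * (u1 x * cexp (m * x%:C) - u x * (m * cexp (m * x%:C)) - (u1 0 - u 0 * m)).
Proof.
move=> mk x0; have mA : measurable (`]0, x] : set R) by exact: measurable_itv.
have sub : `]0, x] `<=` @halfline R.
  by move=> t; rewrite /halfline /= !in_itv/= => /andP[->].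
have iL : cintegrable `]0, x] (fun t => cexp (m * t%:C) * f t).
  apply: inL2onM => //; first exact: inL2on_cexp_itv.
  by move/inL2P: hf; apply: inL2onS => //; exact: measurable_itv.
have [U U1] := H2_prim hu.
have [iW eW] := cexp_wronskian U U1 mk x0.
have [iA eA] := cint_itv_obnd_cbnd iW.
split => //.
have -> : cint `]0, x] (fun t => cexp (m * t%:C) * f t) =
    cint `]0, x] (fun t => c%:C * (cexp (m * t%:C) * (u2 t - k ^+ 2 * u t))).
  apply: ae_eq_cint => //; first exact: cintegrableZ.
  by apply: ae_impl eqf => t ft /sub /ft ->; rewrite mulrCA.
rewrite cintZ// eA eW; congr (_ * _).
by rewrite mulr0 cexp0 !mulr1 addrAC subrr add0r.
Qed.

(** Only the vertex term remains: [u] and [u1] are bounded while [cexp (k * t)] decays, so the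
    Wronskian vanishes at infinity. *)
Lemma halfline_green : complex.Re k < 0 ->
  cintegrable (@halfline R) (fun t => cexp (k * t%:C) * f t) /\
  cint (@halfline R) (fun t => cexp (k * t%:C) * f t) = - (c%:C * (u1 0 - u 0 * k)).
Proof.
move=> k0; have mH : measurable (@halfline R) by exact: measurable_itv.
have Le := inL2on_cexp k0.
split; first by apply: inL2onM => //; exact/inL2P.
have [U U1] := H2_prim hu.
have [/inL2P L /inL2P L1 /inL2P L2 _ _] := hu.
have Lr : inL2on (@halfline R) (fun t => u2 t - k ^+ 2 * u t).
  have := inL2onD mH L2 (inL2onZ (- k ^+ 2) mH L).
  by congr inL2on; apply/funext => t; rewrite mulNr.
have iW : cintegrable (@halfline R) (fun t => cexp (k * t%:C) * (u2 t - k ^+ 2 * u t)).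
  exact: inL2onM.
have W := cexp_wronskian U U1 (erefl (k ^+ 2)).
have -> : cint (@halfline R) (fun t => cexp (k * t%:C) * f t) =
    cint (@halfline R) (fun t => c%:C * (cexp (k * t%:C) * (u2 t - k ^+ 2 * u t))).
  apply: ae_eq_cint => //; first by apply: inL2onM => //; exact/inL2P.
    exact: cintegrableZ.
  by apply: ae_impl eqf => t ft /ft ->; rewrite mulrCA.
have [M uM] : exists M, forall x, 0 <= x -> csqnorm (u x) <= M.
  by apply: prim_bounded U _ _; exact/inL2P.
have [M1 u1M] : exists M, forall x, 0 <= x -> csqnorm (u1 x) <= M.
  by apply: prim_bounded U1 _ _; exact/inL2P.
(* [K] bounds [csqnorm (u1 x - k * u x)], and [expR (- (b * x))] is the squared modulus of
   [cexp (k * x)]. *)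
rewrite cintZ// (cint_halfline_decay (K := 2 * (M1 + csqnorm k * M))
  (b := - (2 * complex.Re k)) W iW).
- by rewrite mulr0 cexp0 !mulr1 mulrN.
- by nra.
move=> x x0.
rewrite (_ : _ - _ = (u1 x - k * u x) * cexp (k * x%:C)); last by ring.
rewrite csqnormM csqnorm_cexp_line mulNr opprK ler_pM2r ?expR_gt0//.
apply: le_trans (csqnormD _ _) _; rewrite csqnormN csqnormM ler_pM2l// lerD ?u1M//.
by rewrite ler_wpM2l ?csqnorm_ge0// uM.
Qed.

End Green.

(** On the edge [j], [G] plays the role of [F^{+-,j}] and [e j] that of [F^{+-,j+1}]. The condition
    [al + be = 1] is continuity of [F^{+-,j}] at the vertex, and the one after it is its Kirchhoff
    condition. *)
Lemma green_formula (R : realType) (n : nat) (c : 'I_n -> R) (k : 'I_n -> R[i])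
    (f u u1 u2 : 'I_n -> R -> R[i]) (j : 'I_n) (al be : R[i]) (x : R) :
  let e l (t : R) := cexp (k l * t%:C) in
  let G t := al * e j t + be * cexp (- k j * t%:C) in
  let w := \sum_l (c l)%:C * k l in
  let K l (t : R) := if (l == j) && (x < t) then G x * e j t / w
             else e j x * (if l == j then G t else e l t) / w in
  (forall l, complex.Re (k l) < 0) -> inH f ->
  (forall l, H2 (u l) (u1 l) (u2 l)) ->
  (forall i l, u i 0 = u l 0) -> \sum_l (c l)%:C * u1 l 0 = 0 ->
  (forall l, {ae (@lebesgue_measure R), forall t, @halfline R t ->
     f l t = (c l)%:C * (u2 l t - k l ^+ 2 * u l t)}) ->
  al + be = 1 ->
  (c j)%:C * k j * (al - be) + \sum_(l | l != j) (c l)%:C * k l = 0 ->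
  w != 0 -> 0 <= x ->
  (forall l, cintegrable (@halfline R) (fun t => K l t * f l t)) /\
  u j x = \sum_l cint (@halfline R) (fun t => K l t * f l t).
Proof.
move=> e G w K k0 hf hu u0 kirch eqf ab1 kirchG w0 x0.
pose A : set R := `]0, x]; pose B : set R := `]x, +oo[.
have mA : measurable A by exact: measurable_itv.
have mB : measurable B by exact: measurable_itv.
have mH : measurable (@halfline R) by exact: measurable_itv.
have HAB : @halfline R = A `|` B.
  apply/seteqP; split => t; rewrite /A /B /halfline /= !in_itv /= ?andbT.
    by move=> t0; rewrite t0; case: (leP t x) => _; [left|right].
  by case=> [/andP[]//|xt]; exact: le_lt_trans xt.
have AB : [disjoint A & B].
  apply/disj_setPS => t []; rewrite /A /B /= !in_itv /= andbT => /andP[_ tx].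
  by rewrite ltNge tx.
have hl l := halfline_green (hu l) (hf l) (eqf l) (k0 l).
have [iAe cAe] := itv_green (hu j) (hf j) (eqf j) (erefl _) x0.
have [iAi cAi] := itv_green (m := - k j) (hu j) (hf j) (eqf j) (sqrrN _) x0.
have [iHe cHe] := hl j.
have iBe : cintegrable B (fun t => e j t * f j t).
  by move: iHe; apply: cintegrableS => //; rewrite HAB; exact: subsetUr.
(* Subtracting the identity on []0, x]] from the one on the half line cancels the terms at [0] and
   leaves those at [x]. *)
have cBe : cint B (fun t => e j t * f j t) =
    - ((c j)%:C * (u1 j x * e j x - u j x * (k j * e j x))).
  move: cHe; rewrite HAB cint_setU// -?HAB// cAe => /(canRL (addKr _)) ->.
  by rewrite /e; ring.
have KA t : A t -> (e j x / w * al) * (e j t * f j t) +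
    (e j x / w * be) * (cexp (- k j * t%:C) * f j t) = K j t * f j t.
  rewrite /A /= in_itv /= => /andP[_ tx].
  by rewrite /K eqxx ltNge tx /= /G /e; ring.
have KB t : B t -> (G x / w) * (e j t * f j t) = K j t * f j t.
  by rewrite /B /= in_itv /= andbT /K eqxx => -> /=; ring.
have iKA0 : cintegrable A (fun t => (e j x / w * al) * (e j t * f j t) +
    (e j x / w * be) * (cexp (- k j * t%:C) * f j t)).
  by apply: cintegrableD => //; exact: cintegrableZ.
have iKA : cintegrable A (fun t => K j t * f j t).
  exact: eq_cintegrable KA iKA0.
have iKB : cintegrable B (fun t => K j t * f j t).
  by apply: (eq_cintegrable mB KB); exact: cintegrableZ.
have iKj : cintegrable (@halfline R) (fun t => K j t * f j t).
  by rewrite HAB; exact: cintegrable_setU.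
have KN l : l != j -> (fun t => K l t * f l t) = (fun t => (e j x / w) * (e l t * f l t)).
  move=> lj; apply/funext => t; rewrite /K (negbTE lj) /=; ring.
have iKN l : l != j -> cintegrable (@halfline R) (fun t => K l t * f l t).
  by move=> lj; rewrite KN//; apply: cintegrableZ => //; case: (hl l).
split=> [l|]; first by have [->//|] := eqVneq l j; exact: iKN.
rewrite (bigD1 j)//= [X in X + _](_ : _ = cint A (fun t => K j t * f j t) +
  cint B (fun t => K j t * f j t)); last by rewrite HAB cint_setU// -HAB.
rewrite -(eq_cint KA) -(eq_cint KB) cintD//; [|exact: cintegrableZ..].
rewrite !cintZ// cAe cAi cBe.
(* The other edges contribute vertex terms only. Continuity of [u] replaces each [u l 0] by [u j 0],
   and the Kirchhoff condition turns the sum of the [u1 l 0] into one term on the edge [j]. *)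
have -> : \sum_(l | l != j) cint (@halfline R) (fun t => K l t * f l t) =
    (e j x / w) * (u j 0 * (\sum_(l | l != j) (c l)%:C * k l) + (c j)%:C * u1 j 0).
  transitivity (\sum_(l | l != j) (e j x / w) *
      (u j 0 * ((c l)%:C * k l) - (c l)%:C * u1 l 0)).
    apply: eq_bigr => l lj; rewrite KN// cintZ//; last by case: (hl l).
    by case: (hl l) => _ ->; rewrite (u0 l j); congr (_ * _); ring.
  rewrite -mulr_sumr sumrB -mulr_sumr; congr (_ * (_ + _)).
  move: kirch; rewrite (bigD1 j)//= => /eqP; rewrite addrC addr_eq0 => /eqP ->.
  by rewrite opprK.
have wE : w = (c j)%:C * k j + \sum_(l | l != j) (c l)%:C * k l.
  by rewrite /w (bigD1 j).
set S := \sum_(l | l != j) _ in kirchG wE *.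
have ee : e j x * cexp (- k j * x%:C) = 1.
  by rewrite -cexpD mulNr subrr cexp0.
rewrite /G -/(e j x); set E := e j x in ee *; set F := cexp _ in ee *.
(* The right-hand side is [c j] times the Wronskian of [e j] and [G]. *)
have w2 : w = 2 * be * (c j)%:C * k j.
  rewrite wE (_ : S = - ((c j)%:C * k j * (al - be))); last first.
    by apply/eqP; rewrite -addr_eq0 addrC kirchG.
  rewrite -[X in X + _ = _]mulr1 -[X in _ * X + _ = _]ab1; ring.
(* The grouping isolates [E * F = 1], the Kirchhoff expression of [G] as the factor of [u j 0], and
   [1 - (al + be)] as the factor of [u1 j 0]. *)
rewrite [RHS](_ : _ = w^-1 * (2 * be * (c j)%:C * k j) * u j x * (E * F) +
  w^-1 * E * (u j 0 * ((c j)%:C * k j * (al - be) + S) +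
    (c j)%:C * u1 j 0 * (1 - (al + be)))); last by ring.
by rewrite ee kirchG ab1 -w2 mulVf// subrr !mulr0 !addr0 mulr1 mulr0 mul1r addr0.
Qed.

(** * The complex square root *)

Section SquareRoot.
Variable R : realType.
Implicit Types z : R[i].

Lemma cmod_ge0 z : 0 <= cmod z.
Proof. exact: sqrtr_ge0. Qed.

Lemma sqr_cmod z : cmod z ^+ 2 = complex.Re z ^+ 2 + complex.Im z ^+ 2.
Proof. by rewrite sqr_sqrtr// addr_ge0 ?sqr_ge0. Qed.

Lemma Re_div_cmod z : -1 <= complex.Re z / cmod z <= 1.
Proof.
rewrite -ler_norml normrM normfV [X in _ / X]ger0_norm ?cmod_ge0//.
(* At [z = 0] the quotient is [0] by the convention on inverses. *)
have := cmod_ge0 z; rewrite le_eqVlt => /predU1P[<-|r0].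
  by rewrite invr0 mulr0 ler01.
rewrite ler_pdivrMr// mul1r -sqrtr_sqr ler_wsqrtr// lerDl sqr_ge0//.
Qed.

(** The cosine of [carg z] is the normalised real part in both branches; its sine is [Im z / cmod z]
    because the branches follow the sign of the imaginary part. *)
Lemma carg_polar z : z = (cmod z)%:C * (cos (carg z) +i* sin (carg z)).
Proof.
have := cmod_ge0 z; rewrite le_eqVlt => /predU1P[r0|r0].
  (* At [z = 0] the value of the argument is irrelevant, as the modulus factor vanishes. *)
  have := sqr_cmod z; rewrite -r0 expr0n /= => /esym/eqP.
  rewrite paddr_eq0 ?sqr_ge0// !sqrf_eq0 => /andP[/eqP x0 /eqP y0].
  by apply: complex_ext; rewrite ?cReM ?cImM /= ?x0 ?y0 ?mul0r ?subr0 ?addr0.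
pose q := complex.Re z / cmod z.
have rq : cmod z * q = complex.Re z by rewrite mulrC divfK// gt_eqF.
have q2 : 1 - q ^+ 2 = (complex.Im z / cmod z) ^+ 2.
  have r2 : cmod z ^+ 2 != 0 by rewrite sqrf_eq0 gt_eqF.
  rewrite !expr_div_n -[X in X - _](divff r2) -mulrBl sqr_cmod; congr (_ / _); ring.
have qI := Re_div_cmod z.
have sq : sin (acos q) = `|complex.Im z| / cmod z.
  by rewrite sin_acos// q2 sqrtr_sqr normrM normfV (gtr0_norm r0).
apply: complex_ext; rewrite ?cReM ?cImM /= mul0r ?subr0 ?addr0 /carg -/q.
  by case: ifPn => _; rewrite ?cosN acosK.
case: ifPn => [y0|]; rewrite ?sinN sq.
  by rewrite gtr0_norm// mulrC divfK// gt_eqF.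
by rewrite -leNgt => y0; rewrite ler0_norm// mulNr opprK mulrC divfK// gt_eqF.
Qed.

Lemma sqr_csqrt z : csqrt z ^+ 2 = z.
Proof.
rewrite [RHS]carg_polar /csqrt; set t := carg z.
have -> : t = t / 2 + t / 2 by field.
rewrite cosD sinD -[X in _ = X%:C * _](sqr_sqrtr (cmod_ge0 z)) expr2.
rewrite (_ : (t / 2 + t / 2) / 2 = t / 2); last by field.
by apply: complex_ext; rewrite !cReImE /=; ring.
Qed.

(** Half of an argument in [[-pi, pi]] lies where the cosine is nonnegative. *)
Lemma Re_csqrt_ge0 z : 0 <= complex.Re (csqrt z).
Proof.
rewrite /csqrt cReM /= mul0r subr0 mulr_ge0 ?sqrtr_ge0//.
apply: cos_ge0_pihalf.
have a0 := acos_ge0 (Re_div_cmod z); have api := acos_lepi (Re_div_cmod z).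
by rewrite /carg; case: ifPn => _; apply/andP; split; lra.
Qed.

(** Since [Im z] is twice the product of the real and imaginary parts of the root, neither factor
    vanishes, and the nonnegative real part lets the imaginary part inherit the sign of [Im z]. *)
Lemma csqrt_sign z : complex.Im z != 0 ->
  0 < complex.Re (csqrt z) /\ 0 < complex.Im z * complex.Im (csqrt z).
Proof.
move=> z0; have := sqr_csqrt z => /(congr1 (@complex.Im R)); rewrite expr2 cImM => H.
have r0 : complex.Re (csqrt z) != 0.
  by apply: contraNneq z0 => r0; rewrite -H r0 mul0r mulr0 addr0.
have rp : 0 < complex.Re (csqrt z) by rewrite lt_def r0 Re_csqrt_ge0.
split => //.
have i0 : complex.Im (csqrt z) != 0.
  by apply: contraNneq z0 => i0; rewrite -H i0 mul0r mulr0 addr0.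
rewrite -H (_ : _ * _ = complex.Re (csqrt z) * (complex.Im (csqrt z)) ^+ 2 * 2); last by ring.
by rewrite mulr_gt0// mulr_gt0// exprn_even_gt0//.
Qed.

End SquareRoot.

(** * Real points of the spectrum *)

Section RealSpectrum.
Variable R : realType.
Notation mu := (@lebesgue_measure R).

Lemma is_derive_invD1 (x : R) : 0 <= x ->
  is_derive x 1 (fun t : R => (1 + t)^-1) (- (1 + x) ^- 2).
Proof.
move=> x0; have x1 : 1 + x != 0 by rewrite gt_eqF// ltr_wpDr.
by apply: is_derive_eq; rewrite /GRing.scale /= add0r mulr1.
Qed.

Lemma continuous_invD1 (x : R) : 0 <= x -> {for x, continuous (fun t : R => (1 + t)^-1)}.
Proof.
move=> /is_derive_invD1; case=> dh _.
by apply: differentiable_continuous; apply/derivable1_diffP.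
Qed.

Lemma Rprim_lnD1 : Rprim (fun x : R => ln (1 + x)) (fun x => (1 + x)^-1).
Proof.
apply: Rprim_derive => x x0; last exact: continuous_invD1.
have x1 : 0 < 1 + x by rewrite ltr_wpDr.
have dln := is_derive1_ln x1.
by apply: is_derive_eq; rewrite /GRing.scale /= add0r mulr1.
Qed.

Lemma measurable_invD1 : measurable_fun (@halfline R) (fun x => (1 + x)^-1).
Proof.
apply: open_continuous_measurable_fun; first exact: interval_open.
by move=> x; rewrite inE /halfline /= in_itv /= => /andP[/ltW x0 _]; exact: continuous_invD1.
Qed.

(** The antiderivative is [- (1 + x)^-1]. This makes the test datum on the first edge
    square-integrable although [(1 + x)^-1] has a divergent integral. *)
Lemma integrable_invD1_sqr :
  mu.-integrable (@halfline R) (EFin \o (fun x => (1 + x) ^- 2)).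
Proof.
have m1 : measurable_fun (@halfline R) (EFin \o (fun x => (1 + x) ^- 2)).
  apply/measurable_EFinP; under eq_fun do rewrite -exprVn.
  by apply: measurable_funX; exact: measurable_invD1.
apply/integrableP; split => //.
have : (\int[mu]_(x in `[0%R, +oo[) ((1 + x) ^- 2)%:E = 0%:E - (- (1 + 0)^-1)%:E)%E.
  apply: (@ge0_continuous_FTC2y _ _ (fun x : R => - (1 + x)^-1)).
  - by move=> x x0; rewrite invr_ge0 sqr_ge0.
  - apply: continuous_in_subspaceT => x; rewrite inE /= in_itv /= andbT => x0.
    rewrite (_ : (fun t : R => (1 + t) ^- 2) = (fun t => (1 + t)^-1 * (1 + t)^-1)); last first.
      by apply/funext => t; rewrite expr2 invfM.
    have h := continuous_invD1 x0; exact: (cvgM h h).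
  - rewrite -oppr0; apply: cvgN.
    apply/gtr0_cvgV0; first by near=> x; rewrite ltr_wpDr//; near: x; exact: nbhs_pinfty_ge.
    apply/cvgryPge => A; near=> x.
    by rewrite (@le_trans _ _ x) ?lerDr//; near: x; exact: nbhs_pinfty_ge.
  - move=> x /ltW x0; apply: derivableN; by case: (is_derive_invD1 x0).
  - by apply: cvg_at_right_filter; apply: cvgN; exact: continuous_invD1.
  - move=> x; rewrite in_itv /= andbT => /ltW x0.
    have D := is_derive_invD1 x0.
    by rewrite derive1E derive_val opprK.
rewrite -integral_itv_obnd_cbnd//; move=> E.
rewrite (_ : (integral _ _ _) = (\int[mu]_(x in `]0%R, +oo[) ((1 + x) ^- 2)%:E)%E).
  by rewrite E ltry.
by apply: eq_integral => x _; rewrite /= ger0_norm// invr_ge0 sqr_ge0.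
Unshelve. all: end_near.
Qed.

Lemma Re_cint (D : set R) (g : R -> R[i]) :
  complex.Re (cint D g) = \int[mu]_(t in D) complex.Re (g t).
Proof. by []. Qed.

Lemma inL2_decaying_wave (y : R) :
  inL2 (fun x : R => ((1 + x)^-1)%:C * cexp (- (0 +i* y) * x%:C)).
Proof.
have mH : measurable (@halfline R) by exact: measurable_itv.
have m := measurable_invD1.
have [m1 m2] := measurable_cexp_line (- (0 +i* y)) mH.
apply/inL2P; split.
- under eq_fun do rewrite cReZ.
  exact: measurable_funM.
- under eq_fun do rewrite cImZ.
  exact: measurable_funM.
have := integrable_invD1_sqr; apply: eq_integrable => // x _ /=.
rewrite csqnormM csqnorm_cexp_line /= oppr0 mulr0 mul0r expR0 mulr1.
by rewrite /csqnorm /= expr0n addr0 exprVn.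
Qed.

Lemma inH_single n (i : 'I_n) (f : R -> R[i]) : inL2 f ->
  inH (fun k => if k == i then f else fun=> 0).
Proof.
move=> fL k; case: ifP => // _; split; [|split]; try exact: measurable_cst.
have := @integrable0 _ _ _ mu (@halfline R).
apply: eq_integrable => // [|x _ /=]; first exact: measurable_itv.
by rewrite /csqnorm /= expr0n addr0.
Qed.

(** Solvability already fails for one datum: for an imaginary exponent the boundary terms of Green's
    identity stay bounded in [x], while the integral grows logarithmically. *)
Lemma real_not_resolvent n (c a : 'I_n -> R) (lam : R[i]) (i : 'I_n) :
  0 < c i -> a i <= complex.Re lam -> complex.Im lam = 0 ->
  ~ in_resolvent_set c a lam.
Proof.
move=> ci ai lam0 [+ _].
(* Chosen so that [k = i y] satisfies [c i * k ^+ 2 = - (lam - a i)]. *)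
pose y := Num.sqrt ((complex.Re lam - a i) / c i).
have y2 : (c i) * y ^+ 2 = complex.Re lam - a i.
  rewrite sqr_sqrtr; first by rewrite mulrC divfK// gt_eqF.
  by rewrite divr_ge0 ?subr_ge0// ltW.
pose k : R[i] := 0 +i* y.
(* [e^{k t} f t = 1 / (1 + t)] has a divergent integral. *)
pose f (x : R) := ((1 + x)^-1)%:C * cexp (- k * x%:C).
have fL : inL2 f := inL2_decaying_wave y.
move=> /(_ _ (inH_single i fL)) [u [[u1 [u2 [hu _ _ ae]]] _]].
have eqf : {ae mu, forall x, @halfline R x ->
    f x = (c i)%:C * (u2 i x - k ^+ 2 * u i x)}.
  apply: ae_impl (ae i) => x /[apply]; rewrite eqxx => <-.
  have -> : lam = (a i)%:C + (c i)%:C * (y ^+ 2)%:C.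
    by apply: complex_ext; rewrite !cReImE /= ?y2 ?lam0 ?mul0r ?mulr0 ?subr0 ?addr0 // addrC subrK.
  have -> : k ^+ 2 = - (y ^+ 2)%:C.
    by apply: complex_ext; rewrite expr2 !cReImE /= ?mul0r ?mulr0 ?sub0r ?addr0 ?oppr0 ?expr2.
  ring.
have [U U1] := H2_prim (hu i).
have [/inL2P L /inL2P L1 /inL2P L2 _ _] := hu i.
have [M uM] : exists M, forall x, 0 <= x -> csqnorm (u i x) <= M.
  by apply: prim_bounded U _ _; exact/inL2P.
have [M1 u1M] : exists M, forall x, 0 <= x -> csqnorm (u1 i x) <= M.
  by apply: prim_bounded U1 _ _; exact/inL2P.
have lnE (x : R) : 0 <= x -> ln (1 + x) =
    complex.Re (cint `]0, x] (fun t => cexp (k * t%:C) * f t)).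
  move=> x0; have [il] := Rprim_lnD1 x0.
  rewrite addr0 ln1 add0r => ->.
  rewrite Re_cint -Rintegral_itv_obnd_cbnd; last first.
    by move: il; apply: integrableS => //; exact: subset_itv_oc_cc.
  apply: eq_Rintegral => t _.
  by rewrite /f mulrCA -cexpD mulNr subrr cexp0 mulr1.
(* A bound, uniform in [x], for the squared modulus of the boundary terms; the exponential has
   modulus [1]. *)
pose K := (csqnorm (c i)%:C) * (2 * (2 * (M1 + M * csqnorm k) + csqnorm (u1 i 0 - u i 0 * k))).
have lnK (x : R) : 0 <= x -> ln (1 + x) ^+ 2 <= K.
  move=> x0; rewrite lnE//; have [_ ->] := itv_green (hu i) fL eqf (erefl _) x0.
  set z := _%:C * _; apply: (@le_trans _ _ (csqnorm z)).
    by rewrite lerDl sqr_ge0.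
  rewrite /z csqnormM ler_wpM2l ?csqnorm_ge0//.
  apply: le_trans (csqnormD _ _) _; rewrite ler_pM2l// csqnormN lerD2r.
  rewrite (_ : _ - _ = (u1 i x - u i x * k) * cexp (k * x%:C)); last by ring.
  rewrite csqnormM csqnorm_cexp_line /= mulr0 mul0r expR0 mulr1.
  apply: le_trans (csqnormD _ _) _; rewrite csqnormN csqnormM ler_pM2l// lerD ?u1M//.
  by rewrite ler_wpM2r ?csqnorm_ge0// uM.
have K0 : 0 <= K by apply: le_trans (lnK 0 (lexx _)); rewrite sqr_ge0.
(* At this point the logarithm is [K + 1], and [(K + 1) ^+ 2 <= K] contradicts [0 <= K]. *)
have := lnK (expR (K + 1) - 1); rewrite (_ : 1 + _ = expR (K + 1)) ?expRK; last by ring.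
have e1 : 0 <= expR (K + 1) - 1.
  have := expR_ge1Dx (K + 1); lra.
by move=> /(_ e1); nra.
Qed.

End RealSpectrum.

(** * The kernel *)

Section KernelExponents.
Variables (R : realType) (n : nat) (c a : 'I_n -> R) (lam : R[i]).
Hypotheses (hc : forall k, 0 < c k) (hlam : complex.Im lam != 0).

Definition kap (k : 'I_n) : R[i] := sgn lam * 'i * xi c a lam k.

Lemma sgnE : sgn lam = 1 \/ sgn lam = -1.
Proof. by rewrite /sgn; case: ifP; [left|right]. Qed.

Lemma Im_ratio k : complex.Im ((lam - (a k)%:C) / (c k)%:C) = complex.Im lam / c k.
Proof.
have -> : ((c k)%:C : R[i])^-1 = (c k)^-1%:C by rewrite fmorphV.
by rewrite mulrC cImZ cImD cImN /= subr0 mulrC.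
Qed.

Lemma Re_xi_gt0 k : 0 < complex.Re (xi c a lam k).
Proof.
by apply: (csqrt_sign _).1; rewrite Im_ratio mulf_neq0// invr_eq0 gt_eqF.
Qed.

Lemma xi_neq0 k : xi c a lam k != 0.
Proof. by have := Re_xi_gt0 k; apply: contraTneq => ->; rewrite ltxx. Qed.

(** This turns the resolvent equation into [f = c * (u2 - kap ^+ 2 * u)], the form needed for
    Green's identity. *)
Lemma sqr_kap k : (c k)%:C * kap k ^+ 2 = - (lam - (a k)%:C).
Proof.
have ck : (c k)%:C != 0 :> R[i] by rewrite fmorph_eq0 gt_eqF.
have sqrM3 (s i z : R[i]) : (s * i * z) ^+ 2 = s ^+ 2 * i ^+ 2 * z ^+ 2 by ring.
rewrite /kap sqrM3 sqr_csqrt sqr_i.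
have -> : sgn lam ^+ 2 = 1 by case: sgnE => ->; rewrite ?sqrrN expr1n.
by field.
Qed.

(** The real part is minus [sgn lam] times [Im xi], and [Im xi] has the sign of [Im lam]; the sign
    in the kernel selects the decaying exponential. *)
Lemma Re_kap_lt0 k : complex.Re (kap k) < 0.
Proof.
have z0 : complex.Im ((lam - (a k)%:C) / (c k)%:C) != 0.
  by rewrite Im_ratio mulf_neq0// invr_eq0 gt_eqF.
have [_] := csqrt_sign z0.
rewrite -/(xi c a lam k) Im_ratio mulrAC pmulr_lgt0 ?invr_gt0// => H.
have -> : complex.Re (kap k) = - complex.Re (sgn lam) * complex.Im (xi c a lam k).
  by rewrite /kap /sgn; case: ifP => _; rewrite !cReImE /=; ring.
rewrite /sgn; case: ifPn => [l0|].
  by rewrite /= mulNr mul1r oppr_lt0; move: H; rewrite pmulr_rgt0.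
rewrite -leNgt le_eqVlt (negbTE hlam) /= => l0.
by rewrite opprK mul1r; move: H; rewrite nmulr_rgt0.
Qed.

Lemma wlE : wl c a lam = \sum_k (c k)%:C * kap k.
Proof. by rewrite /wl mulr_sumr; apply: eq_bigr => k _; rewrite /kap; ring. Qed.

(** Every summand has negative real part, and the index [k] witnesses that the sum is not empty. *)
Lemma wl_neq0 (k : 'I_n) : wl c a lam != 0.
Proof.
have : complex.Re (wl c a lam) < 0; last by apply: contraTneq => ->; rewrite ltxx.
rewrite wlE (big_morph (@complex.Re R) (@cReD R) (erefl _)).
have neg l : complex.Re ((c l)%:C * kap l) < 0 by rewrite cReZ nmulr_llt0 ?Re_kap_lt0.
rewrite (bigD1 k)//= -[X in _ < X]addr0 ltr_leD//.
by apply: sumr_le0 => l _; exact: ltW.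
Qed.

Lemma Ffun_off (j k : 'I_n) (x : R) : k != j -> Ffun c a lam j k x = cexp (kap k * x%:C).
Proof. by rewrite /Ffun => /negbTE ->. Qed.

(** The cosine is even and the sine odd, so [sgn lam] is absorbed into [kap] and the coefficients
    are the same for both signs. *)
Lemma Ffun_diag (j : 'I_n) (x : R) : Ffun c a lam j j x =
  (1 + sxi c a lam j) / 2 * cexp (kap j * x%:C) +
  (1 - sxi c a lam j) / 2 * cexp (- kap j * x%:C).
Proof.
have i0 : 'i != 0 :> R[i] by rewrite eq_complex /= oner_eq0 andbF.
rewrite /Ffun eqxx /ccos /csin; set z := 'i * (_ * _).
have -> : kap j * x%:C = sgn lam * z by rewrite /kap /z; ring.
have -> : - kap j * x%:C = - (sgn lam * z) by rewrite /kap /z; ring.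
case: sgnE => ->; rewrite ?(mul1r z) ?(mulN1r z) ?opprK;
  by move: (cexp z) (cexp (- z)) => p q; field.
Qed.

(** The Kirchhoff condition of [F^{+-,j}]: the coefficients differ by [sxi j], whose definition
    solves exactly this equation. *)
Lemma kap_sxi (j : 'I_n) :
  (c j)%:C * kap j * ((1 + sxi c a lam j) / 2 - (1 - sxi c a lam j) / 2) +
  \sum_(l | l != j) (c l)%:C * kap l = 0.
Proof.
have cj : (c j)%:C != 0 :> R[i] by rewrite fmorph_eq0 gt_eqF.
have xj := xi_neq0 j.
have -> : \sum_(l | l != j) (c l)%:C * kap l =
    sgn lam * 'i * \sum_(l | l != j) (c l)%:C * xi c a lam l.
  by rewrite mulr_sumr; apply: eq_bigr => l _; rewrite /kap; ring.
by rewrite /sxi /kap; field; rewrite cj xj.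
Qed.

End KernelExponents.

(** It ensures that [F^{+-,j+1}] is a pure exponential on the edge [j]. *)
Lemma ordS_neq n (j : 'I_n) : (2 <= n)%N -> ordS j != j.
Proof.
move=> n2; apply/eqP => /(congr1 val) /=.
(* The last index wraps around to [0], which differs from it because [2 <= n]. *)
have := ltn_ord j; rewrite leq_eqVlt => /predU1P[jn|jn].
  by rewrite [X in (X %% _)%N]jn modnn => j0; move: n2; rewrite -jn -j0.
by rewrite modn_small// => /eqP; rewrite gtn_eqF.
Qed.

Theorem theorem3p8 (R : realType) (n : nat) (hn : (2 <= n)%N)
    (c a : 'I_n -> R)
    (hc : forall k, 0 < c k)
    (ha0 : forall k, 0 <= a k)
    (hamono : forall i j : 'I_n, (i <= j)%N -> a i <= a j)
    (f : 'I_n -> R -> R[i]) (hf : inH f)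
    (lam : R[i]) (hres : in_resolvent_set c a lam)
    (hre : forall i : 'I_n, nat_of_ord i = 0%N -> a i <= complex.Re lam)
    (u : 'I_n -> R -> R[i]) (hu : resolvent_eq c a lam f u)
    (j : 'I_n) (x : R) (hx : 0 <= x) :
  (forall k, cintegrable (@halfline R) (fun x' => Kern c a lam j x k x' * f k x'))
  /\ u j x = \sum_(k < n) cint (@halfline R) (fun x' => Kern c a lam j x k x' * f k x').
Proof.
have n0 : (0 < n)%N by exact: ltn_trans hn.
(* The bound on [Re lam] concerns the first edge, which therefore carries the obstruction for real
   [lam]. *)
have hlam : complex.Im lam != 0.
  apply/eqP => lam0; pose i0 := Ordinal n0.
  exact: (real_not_resolvent (hc i0) (hre i0 erefl) lam0 hres).
have [u1 [u2 [hH2 u0 kirch ae]]] := hu.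
have eqf l : {ae (@lebesgue_measure R), forall t, @halfline R t ->
    f l t = (c l)%:C * (u2 l t - kap c a lam l ^+ 2 * u l t)}.
  apply: ae_impl (ae l) => t /[apply] <-.
  by rewrite mulrBr mulrA sqr_kap//; ring.
have ab : (1 + sxi c a lam j) / 2 + (1 - sxi c a lam j) / 2 = 1 by field.
have w0 := wl_neq0 a hc hlam j; rewrite wlE in w0.
have [H1 H2] := green_formula (Re_kap_lt0 a hc hlam) hf hH2 u0 kirch eqf ab
  (kap_sxi a hc hlam j) w0 hx.
(* The kernel matches that of [green_formula] with [al] and [be] equal to half of [1 + sxi j] and of
   [1 - sxi j]. *)
have KE k t : Kern c a lam j x k t = (if (k == j) && (x < t)
  then ((1 + sxi c a lam j) / 2 * cexp (kap c a lam j * x%:C) +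
       (1 - sxi c a lam j) / 2 * cexp (- kap c a lam j * x%:C)) *
       cexp (kap c a lam j * t%:C) / \sum_l (c l)%:C * kap c a lam l
  else cexp (kap c a lam j * x%:C) *
    (if k == j then (1 + sxi c a lam j) / 2 * cexp (kap c a lam j * t%:C) +
       (1 - sxi c a lam j) / 2 * cexp (- kap c a lam j * t%:C)
     else cexp (kap c a lam k * t%:C)) / \sum_l (c l)%:C * kap c a lam l).
  have jS : j != ordS j by rewrite eq_sym ordS_neq.
  rewrite /Kern wlE (Ffun_off _ _ _ _ jS) Ffun_diag.
  have [->|kj] := eqVneq k j; last by rewrite /= Ffun_off.
  by rewrite /= Ffun_off// Ffun_diag.
have fE k : (fun t => Kern c a lam j x k t * f k t) = _ :=
  funext (fun t => congr1 ( *%R^~ _) (KE k t)).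
split=> [k|]; first by rewrite fE; exact: H1.
by rewrite H2; apply: eq_bigr => k _; rewrite fE.
Qed.
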